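(* Let $a, b, k_1, k_2 \in \mathbb{R}_{>0}$, let $Z$ be a real random variable with density $f_Z(z) = \frac{1}{2ab\Gamma(a)} \exp\left(-\left|\frac{z}{b}\right|^{\frac1a}\right)$, and let $L(z) = k_1 z$ for $z \ge 0$ and $L(z) = -k_2 z$ for $z < 0$. Let $C$ be the value of $c \in \mathbb{R}$ satisfying $\frac{d}{dc}\mathrm{E}[L(Z+c)] = 0$. Then \begin{align*} \mathrm{E}[L(Z)] - \mathrm{E}[L(Z+C)] &= \frac{(k_1+k_2)b}{2\Gamma(a)}\,\gamma\left(2a, \left|\frac{C}{b}\right|^{\frac1a}\right), \\ \frac{\mathrm{E}[L(Z+C)]}{\mathrm{E}[L(Z)]} &= \frac{1}{\Gamma(2a)}\,\Gamma\left(2a, \left|\frac{C}{b}\right|^{\frac1a}\right). \end{align*}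
   Context: For $a>0$ and $x \ge 0$: $\Gamma(a) = \int_0^{+\infty} t^{a-1}e^{-t}\,dt$ is the gamma function, $\Gamma(a,x) = \int_x^{+\infty} t^{a-1}e^{-t}\,dt$ is the upper incomplete gamma function, and $\gamma(a,x) = \int_0^x t^{a-1}e^{-t}\,dt$ is the lower incomplete gamma function. $\mathrm{E}$ denotes expected value. The number $C$ is the point at which $c \mapsto \mathrm{E}[L(Z+c)]$ attains its minimum over $\mathbb{R}$; equivalently, it is the real number satisfying $\gamma\left(a, \left|\frac{C}{b}\right|^{\frac1a}\right) = \mathrm{Sgn}(C)\frac{k_2-k_1}{k_1+k_2}\Gamma(a)$, where $\mathrm{Sgn}(c) = 1$ if $c \ge 0$ and $-1$ if $c<0$. *)

(* Defs.v *)
From mathcomp Require Import all_boot all_order all_algebra.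
From mathcomp Require Import all_classical all_reals all_analysis.

Set Implicit Arguments.
Unset Strict Implicit.
Unset Printing Implicit Defensive.

Import Order.TTheory GRing.Theory Num.Theory.
Import numFieldNormedType.Exports.

Local Open Scope classical_set_scope.
Local Open Scope ring_scope.

(* For a < 1 the integrand is singular at 0, where [powR] returns the
   conventional value 0; the endpoints left out below are null sets. *)
Definition gamma_integrand (R : realType) (a t : R) : R :=
  t `^ (a - 1) * expR (- t).

Definition Gamma (R : realType) (a : R) : R :=
  \int[@lebesgue_measure R]_(t in `]0, +oo[) gamma_integrand a t.

Definition upper_gamma (R : realType) (a x : R) : R :=
  \int[@lebesgue_measure R]_(t in `]x, +oo[) gamma_integrand a t.

Definition lower_gamma (R : realType) (a x : R) : R :=
  \int[@lebesgue_measure R]_(t in `]0, x]) gamma_integrand a t.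

Definition gg_pdf (R : realType) (a b z : R) : R :=
  (2 * a * b * Gamma a)^-1 * expR (- (`|z / b| `^ a^-1)).

Definition has_density (d : measure_display) (T : measurableType d)
    (R : realType) (P : probability T R) (Z : {RV P >-> R}) (f : R -> R) : Prop :=
  [/\ measurable_fun setT f, (forall x, 0 <= f x) &
      forall A : set R, measurable A ->
        distribution P Z A = (\int[@lebesgue_measure R]_(x in A) (f x)%:E)%E].

Definition loss (R : realType) (k1 k2 z : R) : R :=
  if 0 <= z then k1 * z else - k2 * z.

(* Main.v *)
From HB Require Import structures.
Require Import Defs.
From mathcomp Require Import all_boot all_order all_algebra.
From mathcomp Require Import all_classical all_reals all_analysis.
From mathcomp Require Import measurable_realfun ring lra.

Set Implicit Arguments.
Unset Strict Implicit.

Import Order.TTheory GRing.Theory Num.Theory.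
Import numFieldNormedType.Exports.
Local Open Scope classical_set_scope.
Local Open Scope ring_scope.

(** Write [L] for the loss, [f] for the density of [Z], [M c] for the expected
    loss at shift [c] and [T x] for the tail moment, the integral of [z f(z)]
    over [z > x].

    The loss is convex and positively homogeneous: if [s u] is [k1] for
    [u >= 0] and [- k2] for [u < 0], then [L u = s u * u], and
    [s u * v <= L v] for all [v].  Averaging the inequality with
    [u = Z + C] and [v = Z + c] shows that [E s(Z + C)] is a subgradient of [M]
    at [C] ([mean_loss_subgradient]); since [M] has derivative [0] at [C], this
    number is [0] ([mean_slope_critical]).  Convexity thus stands in for
    differentiation under the expectation sign.  Averaging the equality gives,
    as [E Z = 0] by symmetry,
    [[ M c = (k1 + k2) E[Z; Z >= - c] + c * E s(Z + c), ]]
    whose last term vanishes both at [c = 0] and at [c = C].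

    The density is even, so [Z] has mean zero over [[- c, c]] when [c > 0], and
    hence [E[Z; Z >= - c] = T |c|] whatever the sign of [c]
    ([tail_moment_even_density]).

    Finally the substitution [z = b t^a] turns [T x] into
    [b / (2 Gamma(a))] times the upper incomplete gamma function of parameter
    [2 a] at [(x / b)^(1/a)] ([gg_tail_moment]).  Hence [M 0] and [M C] are the
    same multiple of [Gamma(2a)] and of [Gamma(2a, |C/b|^(1/a))], and both
    identities follow from [Gamma = lower_gamma + upper_gamma].

    The remaining work is analytic: [Gamma(a)] is a positive real number for all
    [a > 0] ([integrable_gamma_integrand], [Gamma_gt0]), and [Z] is integrable
    because its tail moment at [0] is finite. *)

(** * Expectations under a density *)

Section density.
Context (d : measure_display) (T : measurableType d) (R : realType).
Variables (P : probability T R) (Z : {RV P >-> R}) (f : R -> R).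
Hypothesis Zf : has_density Z f.
Local Notation mu := (@lebesgue_measure R).
Local Open Scope ereal_scope.

Lemma measurable_density : measurable_fun [set: R] f.
Proof. by case: Zf. Qed.

Lemma measurable_density_EFin : measurable_fun [set: R] (EFin \o f).
Proof. by apply/measurable_EFinP; exact: measurable_density. Qed.

Lemma density_ge0 x : (0 <= f x)%R.
Proof. by case: Zf. Qed.

(** The Borel structure that the reals inherit from [R : realType] and the one
    carrying the Lebesgue measure have the same measurable sets but are distinct
    structures; the law of [Z] is used below over the latter. *)
Let Zleb : T -> measurableTypeR R := Z.

Let measurable_Zleb : measurable_fun [set: T] Zleb.
Proof. exact: (@measurable_funPT _ _ _ _ Z). Qed.

HB.instance Definition _ :=
  isMeasurableFun.Build _ _ T (measurableTypeR R) Zleb measurable_Zleb.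

Let law : probability (measurableTypeR R) R := distribution P Zleb.

Let lawE A : measurable A -> law A = \int[mu]_(x in A) (f x)%:E.
Proof. by move=> mA; case: Zf => _ _ /(_ A mA). Qed.

(** Domination makes the Radon-Nikodym derivative of the law available; it must
    agree with [f] almost everywhere. *)
Lemma law_dominates : law `<< mu.
Proof.
apply/null_content_dominatesP => A mA A0; rewrite lawE//.
by apply: null_set_integral => //; exact: measurable_funTS measurable_density_EFin.
Qed.

Lemma ge0_expectation_density (g : R -> \bar R) :
  measurable_fun [set: R] g -> (forall x, 0 <= g x) ->
  \int[P]_w g (Z w) = \int[mu]_x (g x * (f x)%:E).
Proof.
move=> mg g0.
have mf := measurable_density_EFin.
have intRN := Radon_Nikodym_SigmaFinite.f_integrable law_dominates.
transitivity (\int[law]_x g x); first by rewrite ge0_integral_distribution.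
rewrite -(Radon_Nikodym_SigmaFinite.change_of_variables law_dominates)//.
apply: ge0_ae_eq_integral => //.
- by apply: emeasurable_funM => //; exact: measurable_int intRN.
- exact: emeasurable_funM.
- move=> x _; rewrite mule_ge0//.
  exact: (Radon_Nikodym_SigmaFinite.f_ge0 law_dominates).
- by move=> x _; rewrite mule_ge0// lee_fin density_ge0.
- apply: ae_eqe_mul2l; apply: integral_ae_eq => // A _ mA.
  by rewrite -(Radon_Nikodym_SigmaFinite.f_integral law_dominates)//; exact: lawE.
Qed.

Section even.
Hypothesis f_even : forall x, f (- x)%R = f x.

Lemma ge0_expectation_density_opp (g : R -> \bar R) :
  measurable_fun [set: R] g -> (forall x, 0 <= g x) ->
  \int[P]_w g (- Z w)%R = \int[P]_w g (Z w).
Proof.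
move=> mg g0.
have mf := measurable_density_EFin.
have mgN : measurable_fun [set: R] (g \o -%R) by exact: measurableT_comp.
rewrite (ge0_expectation_density mg g0).
rewrite -[LHS]/(\int[P]_w (g \o -%R) (Z w)).
rewrite (ge0_expectation_density mgN (fun x => g0 (- x)%R)).
pose h x := g x * (f x)%:E.
have mh : measurable_fun [set: R] h by exact: emeasurable_funM.
under eq_integral do rewrite -f_even -/(h _).
have mN : measurable_fun [set: measurableTypeR R] (-%R : _ -> measurableTypeR R).
  exact: oppr_measurable.
rewrite -[LHS](@ge0_integral_pushforward _ _ _ _ R _ mN mu setT h)//.
  by apply: eq_measure_integral => A mA _; exact: lebesgue_measureN.
by move=> x _; rewrite /h mule_ge0// lee_fin density_ge0.
Qed.

(** The negative part of an odd function is the reflection of its positive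
    part, so by symmetry both have the same mean. *)
Lemma expectation_odd0 (g : R -> R) :
    measurable_fun [set: R] g -> (forall x, g (- x) = - g x)%R ->
    P.-integrable [set: T] (fun w => (g (Z w))%:E) ->
  \int[P]_w (g (Z w))%:E = 0.
Proof.
move=> mg godd intg; rewrite integralE.
pose gE := EFin \o g.
have mgE : measurable_fun [set: R] gE by exact/measurable_EFinP.
have -> : \int[P]_w (fun w => (g (Z w))%:E)^\- w = \int[P]_w gE^\+ (- Z w)%R.
  by apply: eq_integral => w _; rewrite funenegE funeposE /gE /= godd.
rewrite ge0_expectation_density_opp//; last exact: measurable_funepos.
have -> : \int[P]_w gE^\+ (Z w) = \int[P]_w (fun w => (g (Z w))%:E)^\+ w.
  by apply: eq_integral => w _; rewrite !funeposE.
by rewrite subee// integrable_pos_fin_num.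
Qed.

End even.
End density.

(** * A convex loss and its subgradient *)

Section subgradient.
Context (R : realType).

(** Difference quotients are at least [s] on the right of [x] and at most [s] on
    its left, so that the derivative at [x], if it exists, is [s]. *)
Lemma subgradient_derive0 (F : R -> R) (x s : R) :
  is_derive x 1 F 0 -> (forall y, F x + s * (y - x) <= F y) -> s = 0.
Proof.
move=> [/cvg_ex[l Fl] dF0] subF.
have l0 : l = 0 by rewrite -dF0; apply/esym/cvg_lim.
rewrite {}l0 in Fl; apply/eqP; rewrite eq_le; apply/andP; split.
- apply: (cvgr_to_ge (cvg_dnbhs_at_right Fl)); near=> h.
  have h0 : 0 < h by [].
  rewrite /= -[_ *: _]/(_ * _) mulrC ler_pdivlMr// -[h%:A]/(h * 1) mulr1.
  by have := subF (h + x); rewrite addrK -lerBrDl.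
- apply: (cvgr_to_le (cvg_dnbhs_at_left Fl)); near=> h.
  have h0 : h < 0 by [].
  rewrite /= -[_ *: _]/(_ * _) mulrC ler_ndivrMr// -[h%:A]/(h * 1) mulr1.
  by have := subF (h + x); rewrite addrK -lerBrDl.
Unshelve. all: by end_near. Qed.

End subgradient.

Section loss.
Context (d : measure_display) (T : measurableType d) (R : realType).
Variables (P : probability T R) (X : T -> R) (k1 k2 : R).
Hypothesis intX : P.-integrable [set: T] (EFin \o X).

(** A subgradient of the loss, equal to its derivative away from the origin. *)
Definition slope (z : R) : R := if 0 <= z then k1 else - k2.

Lemma loss_slope z : loss k1 k2 z = slope z * z.
Proof. by rewrite /loss /slope; case: ifP. Qed.

Lemma slope_indic z : slope z = (k1 + k2) * \1_`[0, +oo[ z - k2.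
Proof.
rewrite /slope indicE; have [z0|z0] := leP 0 z.
  by rewrite mem_set/= ?in_itv/= ?z0// mulr1 addrK.
by rewrite memNset/= ?in_itv/= ?leNgt ?z0// mulr0 sub0r.
Qed.

(** [v |-> slope u * v] is a supporting line of the loss: by homogeneity it
    touches the graph at [u] and passes through the origin. *)
Lemma slope_le_loss u v : 0 <= k1 + k2 -> slope u * v <= loss k1 k2 v.
Proof.
by rewrite /slope /loss; case: (leP 0 u) => ?; case: (leP 0 v) => ? ?; nra.
Qed.

Let measurable_X : measurable_fun [set: T] X.
Proof. by apply/measurable_EFinP; exact: measurable_int intX. Qed.

Let intXc c : P.-integrable [set: T] (fun w => (X w + c)%:E).
Proof.
have -> : (fun w => (X w + c)%:E) = ((EFin \o X) \+ (EFin \o cst c))%E by [].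
by apply: integrableD => //; exact: finite_measure_integrable_cst.
Qed.

Let measurable_slope c : measurable_fun [set: T] (fun w => slope (X w + c)).
Proof.
under eq_fun do rewrite slope_indic.
apply: measurable_funB => //; apply: measurable_funM => //.
apply: (@measurableT_comp _ _ _ _ _ _ (\1_`[0, +oo[%classic : R -> R)).
  exact: measurable_indic.
exact: measurable_funD.
Qed.

Let bounded_slope c : [bounded slope (X w + c) | w in [set: T]].
Proof.
exists (`|k1| + `|k2|); split; first exact: num_real.
move=> M /ltW kM w _ /=; apply: le_trans kM; rewrite /slope.
by case: ifP; rewrite ?normrN ?lerDl ?lerDr.
Qed.

Lemma integrable_slope_mul c (Y : T -> R) : P.-integrable [set: T] (EFin \o Y) ->
  P.-integrable [set: T] (fun w => (slope (X w + c) * Y w)%:E).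
Proof.
exact: (integrableMr measurableT (@measurable_slope c) (@bounded_slope c)).
Qed.

Lemma integrable_loss c :
  P.-integrable [set: T] (fun w => (loss k1 k2 (X w + c))%:E).
Proof.
under eq_fun do rewrite loss_slope.
exact: (@integrable_slope_mul c (fun w => X w + c) (intXc c)).
Qed.

Definition mean_slope c := \int[P]_w slope (X w + c).

Let integrable_slope c : P.-integrable [set: T] (fun w => (slope (X w + c))%:E).
Proof.
have := integrable_slope_mul c (finite_measure_integrable_cst P 1 measurableT).
by under eq_fun do rewrite mulr1.
Qed.

Lemma mean_loss_subgradient c c' : 0 <= k1 + k2 ->
  \int[P]_w loss k1 k2 (X w + c) + mean_slope c * (c' - c) <=
  \int[P]_w loss k1 k2 (X w + c').
Proof.
move=> k0; have intL := integrable_loss c.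
rewrite /mean_slope -(RintegralZr _ measurableT (integrable_slope c)).
have intS : P.-integrable [set: T]
    (fun w => (slope (X w + c) * (c' - c))%:E).
  exact: (@integrable_slope_mul c (cst (c' - c))
    (finite_measure_integrable_cst P (c' - c) measurableT)).
rewrite -RintegralD//.
apply: le_Rintegral => //.
- exact: (integrableD measurableT intL intS).
- exact: integrable_loss.
- move=> w _; rewrite loss_slope -mulrDr.
  rewrite (_ : X w + c + (c' - c) = X w + c'); last by ring.
  exact: slope_le_loss.
Qed.

Lemma mean_slope_critical (C : R) : 0 <= k1 + k2 ->
  is_derive C 1 (fun c : R => \int[P]_w loss k1 k2 (X w + c)) (0 : R) ->
  mean_slope C = 0.
Proof.
by move=> k0 /subgradient_derive0; apply => c; exact: mean_loss_subgradient.
Qed.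

Lemma integrable_mul_indic (A : set R) : measurable A ->
  P.-integrable [set: T] (fun w => (X w * \1_A (X w))%:E).
Proof.
move=> mA; apply: le_integrable intX => //.
  apply/measurable_EFinP; apply: measurable_funM => //.
  by apply: (@measurableT_comp _ _ _ _ _ _ (\1_A : R -> R)).
move=> w _ /=; rewrite lee_fin normrM indicE.
by case: (_ \in _); rewrite ?normr1 ?mulr1// normr0 mulr0.
Qed.

(** Expand [slope u * u] at [u = X + c], using that [slope] is an affine function
    of the indicator of the half line on which [X + c >= 0]. *)
Lemma mean_loss_decomp c :
  \int[P]_w loss k1 k2 (X w + c) =
  (k1 + k2) * \int[P]_w (X w * \1_`[- c, +oo[ (X w)) - k2 * \int[P]_w X w
    + mean_slope c * c.
Proof.
have iX := integrable_mul_indic (measurable_itv `[- c, +oo[).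
have iS := integrable_slope c.
have iC : P.-integrable [set: T]
    (fun w => ((k1 + k2) * (X w * \1_`[- c, +oo[ (X w)))%:E).
  exact: (integrableZl measurableT (k1 + k2) iX).
have iN : P.-integrable [set: T] (fun w => (k2 * X w)%:E).
  exact: (integrableZl measurableT k2 intX).
have iD : P.-integrable [set: T] (fun w =>
    ((k1 + k2) * (X w * \1_`[- c, +oo[ (X w)) - k2 * X w)%:E).
  exact: (integrableB measurableT iC iN).
have iE : P.-integrable [set: T] (fun w => (slope (X w + c) * c)%:E).
  exact: (integrableZr measurableT c iS).
rewrite /mean_slope -(RintegralZl _ measurableT iX).
rewrite -(RintegralZl _ measurableT intX) -(RintegralZr _ measurableT iS).
rewrite -(RintegralB measurableT iC iN) -(RintegralD measurableT iD iE).
apply: eq_Rintegral => w _; rewrite loss_slope mulrDr; congr (_ + _).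
rewrite slope_indic !indicE.
have -> : (X w + c \in `[0, +oo[%classic) = (X w \in `[(- c), +oo[%classic).
  by apply/idP/idP; rewrite !inE/= !in_itv/= !andbT; lra.
by ring.
Qed.

End loss.

(** * Substitution on an open half line *)

Section substitution.
Context (R : realType).
Local Notation mu := (@lebesgue_measure R).

(** The derivative of [F] may be unbounded near [x] and at infinity, as that of
    [t^a] is at [0] when [a < 1] and at infinity when [a > 1].  So the half line
    is exhausted by compact intervals, on which the substitution rule for
    continuous integrands applies, and monotone convergence concludes. *)
Lemma ge0_integration_by_substitution_itvoy (F G : R -> R) (x y : R) :
  {in `]x, +oo[ &, {homo F : s t / s < t}} ->
  {in `]x, +oo[, forall t, derivable F t 1} ->
  {in `]x, +oo[, continuous F^`()%classic} ->
  {in `]x, +oo[, forall t, 0 <= F^`()%classic t} ->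
  F @` `]x, +oo[ = `]y, +oo[%classic ->
  {in `]y, +oo[, continuous G} ->
  {in `]y, +oo[, forall z, 0 <= G z} ->
  (\int[mu]_(z in `]y, +oo[) (G z)%:E =
   \int[mu]_(t in `]x, +oo[) (G (F t) * F^`()%classic t)%:E)%E.
Proof.
move=> Fincr dF cF' F'0 Fxy cG G0.
pose p n : R := x + n.+1%:R^-1.
pose q n : R := x + n.+1%:R.
have xp n : x < p n by rewrite /p ltrDl invr_gt0.
have pq n : p n <= q n.
  by rewrite /p /q lerD2l (@le_trans _ _ 1)// ?invf_le1// ?ler1n.
pose I n := `[p n, q n]%classic.
pose J n := `[F (p n), F (q n)]%classic.
have Ixy n : I n `<=` `]x, +oo[.
  by move=> t /=; rewrite !in_itv/= andbT => /andP[+ _]; apply: lt_le_trans (xp n).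
have inx t : x < t -> t \in `]x, +oo[ by rewrite in_itv/= andbT.
have Fy t : x < t -> y < F t.
  move=> xt; have : (F @` `]x, +oo[) (F t) by exists t => //=; exact: inx.
  by rewrite Fxy /= in_itv/= andbT.
have iny t : y < t -> t \in `]y, +oo[ by rewrite in_itv/= andbT.
have Jxy n : J n `<=` `]y, +oo[.
  move=> t /=; rewrite !in_itv/= andbT => /andP[+ _]; apply: lt_le_trans (Fy _ (xp n)).
have Fmono s t : x < s -> s <= t -> F s <= F t.
  move=> xs; rewrite le_eqVlt => /predU1P[->//|st]; apply/ltW/Fincr => //.
  - exact: inx.
  - by apply/inx; exact: lt_trans st.
have pm m n : (m <= n)%N -> p n <= p m.
  by move=> mn; rewrite lerD2l lef_pV2 ?posrE// ler_nat.
have qm m n : (m <= n)%N -> q m <= q n.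
  by move=> mn; rewrite lerD2l ler_nat.
have xq n : x < q n by exact: lt_le_trans (pq n).
have ndI : nondecreasing_seq I.
  move=> m n mn; apply/subsetPset => t; rewrite /I /= !in_itv/= => /andP[pt tq].
  by rewrite (le_trans (pm _ _ mn) pt) (le_trans tq (qm _ _ mn)).
have ndJ : nondecreasing_seq J.
  move=> m n mn; apply/subsetPset => t; rewrite /J /= !in_itv/= => /andP[pt tq].
  rewrite (le_trans _ pt) ?(le_trans tq)//.
  - by apply: Fmono => //; exact: qm.
  - by apply: Fmono => //; exact: pm.
have ex t : x < t -> exists n, I n t.
  move=> xt; have tx0 : 0 < t - x by rewrite subr_gt0.
  (* large enough both for [p n] to be below [t] and for [q n] to be above it *)
  pose n := (Num.truncn (t - x) + Num.truncn (t - x)^-1)%N.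
  exists n; rewrite /I /= in_itv/=; apply/andP; split.
    rewrite /p -lerBrDl -[leRHS]invrK lef_pV2 ?posrE ?invr_gt0//.
    apply/ltW; apply: lt_le_trans (truncnS_gt _) _.
    by rewrite ler_nat ltnS leq_addl.
  rewrite /q -lerBlDl; apply/ltW; apply: lt_le_trans (truncnS_gt _) _.
  by rewrite ler_nat ltnS leq_addr.
have UI : \bigcup_n I n = `]x, +oo[%classic.
  apply/seteqP; split; first by move=> t [n _]; exact: Ixy.
  move=> t /=; rewrite in_itv/= andbT => /ex[n Int]; by exists n.
have UJ : \bigcup_n J n = `]y, +oo[%classic.
  apply/seteqP; split; first by move=> t [n _]; exact: Jxy.
  rewrite -Fxy => _ [t /= + <-]; rewrite in_itv/= andbT => xt.
  have [n Int] := ex _ xt; exists n => //; move: Int.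
  rewrite /I /J /= !in_itv/= => /andP[pt tq].
  by rewrite !Fmono.
have cF : {in `]x, +oo[, continuous F}.
  by move=> t xt; apply/differentiable_continuous/derivable1_diffP/dF.
have mG : measurable_fun `]y, +oo[ G.
  apply: open_continuous_measurable_fun; first exact: interval_open.
  by move=> z; rewrite inE; exact: cG.
have mH : measurable_fun `]x, +oo[ (fun t => G (F t) * F^`()%classic t).
  apply: open_continuous_measurable_fun; first exact: interval_open.
  move=> t; rewrite inE/= => xt; apply: continuousM; last exact: cF'.
  apply: continuous_comp; first exact: cF.
  by apply: cG; apply/iny/Fy; move: xt; rewrite in_itv/= andbT.
have cvJ : (\int[mu]_(z in J n) (G z)%:E)%E @[n --> \oo] -->
    (\int[mu]_(z in `]y, +oo[) (G z)%:E)%E.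
  rewrite -UJ; apply: ge0_nondecreasing_set_cvg_integral => //.
  - by move=> n; exact: measurable_itv.
  - by move=> n; apply/measurable_EFinP; apply: measurable_funS mG => //; exact: Jxy.
  - by move=> n z Jz; rewrite lee_fin G0//; exact: (Jxy n).
have cvI : (\int[mu]_(t in I n) (G (F t) * F^`()%classic t)%:E)%E @[n --> \oo] -->
    (\int[mu]_(t in `]x, +oo[) (G (F t) * F^`()%classic t)%:E)%E.
  rewrite -UI; apply: ge0_nondecreasing_set_cvg_integral => //.
  - by move=> n; exact: measurable_itv.
  - by move=> n; apply/measurable_EFinP; apply: measurable_funS mH => //; exact: Ixy.
  - move=> n t It; have := Ixy _ _ It; rewrite /= in_itv/= andbT => xt.
    by rewrite lee_fin mulr_ge0// ?G0 ?F'0//; [apply/iny/Fy|exact: inx].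
apply: cvg_unique cvJ _ => //.
rewrite (_ : (fun n => _) =
  (fun n => \int[mu]_(t in I n) (G (F t) * F^`()%classic t)%:E)%E)//.
apply/funext => n; rewrite /I /J.
apply: (@integration_by_substitution_increasing _ F G (p n) (q n) (pq n)).
- move=> s t /Ixy sx /Ixy tx; exact: Fincr.
- by move=> t tpq; apply: cF'; apply: (Ixy n); exact: subset_itv_oo_cc tpq.
- apply/cvg_ex; exists (F^`()%classic (p n)); apply: cvg_at_right_filter.
  by apply: cF'; exact: inx.
- apply/cvg_ex; exists (F^`()%classic (q n)); apply: cvg_at_left_filter.
  by apply: cF'; exact: inx.
- split.
  + by move=> t tpq; apply: dF; apply: (Ixy n); exact: subset_itv_oo_cc tpq.
  + by apply: cvg_at_right_filter; apply: cF; exact: inx.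
  + by apply: cvg_at_left_filter; apply: cF; exact: inx.
- apply: continuous_in_subspaceT => z; rewrite inE => /(Jxy n) yz.
  exact: cG.
Qed.


Lemma continuous_powR (a t : R) : 0 < t -> {for t, continuous (@powR R ^~ a)}.
Proof.
move=> t0; apply/differentiable_continuous/derivable1_diffP.
by apply: derivable_powR; rewrite in_itv/= andbT.
Qed.

Lemma ge0_integration_by_substitution_powR (a b x : R) (G : R -> R) :
  0 < a -> 0 < b -> 0 <= x ->
  {in `]b * x `^ a, +oo[, continuous G} ->
  {in `]b * x `^ a, +oo[, forall z, 0 <= G z} ->
  (\int[mu]_(z in `](b * x `^ a)%R, +oo[) (G z)%:E =
   \int[mu]_(t in `]x, +oo[)
     (G (b * t `^ a) * (b * (a * t `^ (a - 1))))%:E)%E.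
Proof.
move=> a0 b0 x0 cG G0; pose F t := b * t `^ a.
have pos t : t \in `]x, +oo[ -> 0 < t.
  by rewrite in_itv/= andbT; exact: le_lt_trans.
have dF (t : R) : 0 < t -> is_derive t (1 : R) F (b * (a * t `^ (a - 1))).
  by move=> t0; have := is_derive1_powR a t0 => ?; apply: is_deriveZ.
have F'E (t : R) : 0 < t -> (F^`()%classic) t = b * (a * t `^ (a - 1)).
  by move=> /dF [_]; rewrite derive1E.
transitivity (\int[mu]_(t in `]x, +oo[) (G (F t) * (F^`()%classic) t)%:E)%E.
  apply: ge0_integration_by_substitution_itvoy => //.
  - move=> s t /pos s0 /pos t0 st; rewrite ltr_pM2l//.
    by apply: gt0_ltr_powR; rewrite ?nnegrE// ltW.
  - by move=> t /pos /dF [].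
  - move=> t /pos t0; have near0 : \forall s \near t, 0 < s by exact: lt_nbhsr.
    have FE : {near t, (fun s => b * (a * s `^ (a - 1))) =1 F^`()%classic}.
      by apply: filterS near0 => s s0; rewrite F'E.
    rewrite /continuous_at F'E//; apply: cvg_trans (near_eq_cvg FE) _.
    apply: cvgM; first exact: cvg_cst.
    by apply: cvgM; [exact: cvg_cst|exact: continuous_powR].
  - by move=> t /pos t0; rewrite F'E// !mulr_ge0// ?powR_ge0// ltW.
  - apply/seteqP; split => [_ [t /= + <-]|z /=].
      rewrite !in_itv/= !andbT => xt; rewrite /F ltr_pM2l//.
      by apply: gt0_ltr_powR; rewrite ?nnegrE// ltW// (le_lt_trans x0).
    rewrite !in_itv/= !andbT -ltr_pdivlMl// => xz.
    have xa0 : 0 <= x `^ a by exact: powR_ge0.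
    have z0 : 0 <= b^-1 * z by exact/ltW/(le_lt_trans xa0).
    exists ((b^-1 * z) `^ a^-1).
      rewrite /= in_itv/= andbT -[ltLHS](powRr1 x0) -(divff (lt0r_neq0 a0)).
      by rewrite powRrM gt0_ltr_powR ?nnegrE ?invr_gt0.
    rewrite /F -powRrM mulVf ?gt_eqF// powRr1// mulrA divff ?mul1r//.
    by rewrite gt_eqF.
by apply: eq_integral => t /set_mem/= /pos t0; rewrite F'E.
Qed.

(** * The gamma function *)

Let measurable_itv0y : measurable (`]0, +oo[%classic : set (measurableTypeR R)).
Proof. exact: measurable_itv. Qed.

Lemma integrable_expRN (r : R) : 0 < r ->
  mu.-integrable `]0, +oo[ (fun t => (expR (- r * t))%:E).
Proof.
move=> r0.
have ipdf : mu.-integrable `]0, +oo[ (EFin \o exponential_pdf r).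
  exact: integrableS (integrable_exponential_pdf r0).
have := integrableZl measurable_itv0y r^-1 ipdf.
apply: eq_integrable => // t; rewrite inE/= in_itv/= andbT => t0.
rewrite exponential_pdfE ?ltW// /= -EFinM mulrA mulVf ?mul1r// gt_eqF//.
Qed.

Lemma gamma_integrand_ge0 (a t : R) : 0 <= gamma_integrand a t.
Proof. by rewrite mulr_ge0 ?powR_ge0 ?expR_ge0. Qed.

Lemma measurable_gamma_integrand (a : R) :
  measurable_fun [set: R] (gamma_integrand a).
Proof.
apply: measurable_funM; first exact: measurable_powR.
by apply: measurableT_comp => //; exact: oppr_measurable.
Qed.

(** Up to the factor [a], this is the image of [exp(- u)] under the substitution
    [u = t^a]. *)
Lemma integrable_powR_expRN (a : R) : 0 < a ->
  mu.-integrable `]0, +oo[ (fun t => (t `^ (a - 1) * expR (- (t `^ a)))%:E).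
Proof.
move=> a0; pose h t := expR (- (1 * t `^ a)) * (1 * (a * t `^ (a - 1))).
have h0 t : 0 <= h t.
  by rewrite /h mul1r !mulr_ge0 ?expR_ge0 ?powR_ge0// ltW.
have mh : measurable_fun [set: R] h.
  apply: measurable_funM.
    apply: measurableT_comp => //; apply: measurableT_comp => //.
    by apply: measurable_funM => //; exact: measurable_powR.
  by apply: measurable_funM => //; exact: measurable_funM.
have subst : (\int[mu]_(u in `]0%R, +oo[) (expR (- 1 * u))%:E =
    \int[mu]_(t in `]0%R, +oo[) (h t)%:E)%E.
  have := @ge0_integration_by_substitution_powR a 1 0 (fun u => expR (- u))
    a0 ltr01 (lexx 0).
  rewrite mul1r powR0 ?gt_eqF// => <-.
  - by apply: eq_integral => u _; rewrite mulN1r.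
  - move=> u _; apply: continuous_comp; last exact: continuous_expR.
    exact: continuousN.
  - by move=> u _; exact: expR_ge0.
have inth : mu.-integrable `]0, +oo[ (EFin \o h).
  apply/integrableP; split; first exact/measurable_EFinP/measurable_funTS.
  under eq_integral do rewrite /= ger0_norm//.
  rewrite -subst.
  have /integrableP[_] := integrable_expRN ltr01.
  by under eq_integral do rewrite /= ger0_norm ?expR_ge0//.
have := integrableZl measurable_itv0y a^-1 inth.
apply: eq_integrable => // t _; rewrite /= -EFinM /h; congr EFin.
by rewrite !mul1r; field; rewrite gt_eqF.
Qed.

(** The first summand takes care of [t <= 1], where [t^a <= 1] and therefore
    [exp(- t) <= 1 <= exp(1 - t^a)].  The second takes care of [t > 1], where
    [t^(a-1) <= t^a = (2a)^a (t / (2a))^a <= (2a)^a exp(t / 2)]. *)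
Lemma gamma_integrand_le (a t : R) : 0 < a -> 0 < t ->
  gamma_integrand a t <=
    expR 1 * (t `^ (a - 1) * expR (- (t `^ a)))
    + (2 * a) `^ a * expR (- 2^-1 * t).
Proof.
move=> a0 t0; have [t1|t1] := leP t 1.
  apply: ler_wpDr; first by rewrite mulr_ge0 ?powR_ge0 ?expR_ge0.
  rewrite /gamma_integrand mulrCA ler_wpM2l ?powR_ge0// -expRD ler_expR.
  have ta1 : t `^ a <= 1.
    have <- : 1 `^ a = 1 by rewrite powR1.
    by apply: ge0_ler_powR => //; rewrite ?nnegrE ltW.
  by lra.
apply: ler_wpDl.
  by rewrite !mulr_ge0 ?powR_ge0 ?expR_ge0.
apply: (@le_trans _ _ (t `^ a * expR (- t))).
  rewrite /gamma_integrand ler_wpM2r ?expR_ge0//.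
  by apply: ler_powR; [exact: ltW|rewrite gerBl].
have -> : - t = 2^-1 * - t + - 2^-1 * t by field.
rewrite expRD mulrA ler_wpM2r ?expR_ge0// mulrN expRN ler_pdivrMr ?expR_gt0//.
have a20 : 0 < 2 * a by rewrite mulr_gt0.
have -> : expR (2^-1 * t) = expR (t / (2 * a)) `^ a.
  by rewrite -expRM; congr expR; field; rewrite gt_eqF.
rewrite -powRM ?expR_ge0 ?(ltW a20)//; apply: ge0_ler_powR.
- exact: ltW.
- by rewrite nnegrE ltW.
- by rewrite nnegrE mulr_ge0 ?expR_ge0// ltW.
rewrite mulrC -ler_pdivrMr//; apply: le_trans (expR_ge1Dx _).
by rewrite lerDr.
Qed.

Lemma integrable_gamma_integrand (a : R) : 0 < a ->
  mu.-integrable `]0, +oo[ (EFin \o gamma_integrand a).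
Proof.
move=> a0.
have i1 := integrableZl measurable_itv0y (expR 1) (integrable_powR_expRN a0).
have half_gt0 : 0 < 2^-1 :> R by rewrite invr_gt0.
have i2 := integrableZl measurable_itv0y ((2 * a) `^ a)
  (integrable_expRN half_gt0).
have := integrableD measurable_itv0y i1 i2; apply: le_integrable => //.
  by apply/measurable_EFinP/measurable_funTS; exact: measurable_gamma_integrand.
move=> t /=; rewrite in_itv/= andbT => t0.
rewrite lee_fin ger0_norm ?gamma_integrand_ge0//.
by rewrite (le_trans (gamma_integrand_le a0 t0))// ler_norm.
Qed.

Lemma Gamma_EFin (a : R) : 0 < a ->
  (Gamma a)%:E = (\int[mu]_(t in `]0%R, +oo[) (gamma_integrand a t)%:E)%E.
Proof.
move=> a0; rewrite fineK//.
exact: (integrable_fin_num _ (integrable_gamma_integrand a0)).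
Qed.

(** A zero integral would make the positive integrand vanish almost everywhere on
    a half line of infinite measure. *)
Lemma Gamma_gt0 (a : R) : 0 < a -> 0 < Gamma a.
Proof.
move=> a0; rewrite lt_neqAle Rintegral_ge0 ?andbT//; last first.
  by move=> t _; exact: gamma_integrand_ge0.
apply/eqP => G0.
have : ae_eq mu `]0, +oo[%classic (EFin \o gamma_integrand a) (cst 0%E).
  apply/ae_eq_integral_abs => //.
    by apply/measurable_EFinP/measurable_funTS; exact: measurable_gamma_integrand.
  transitivity (Gamma a)%:E; last by rewrite -G0.
  rewrite Gamma_EFin//.
  by apply: eq_integral => t _; rewrite /= ger0_norm// gamma_integrand_ge0.
move=> [N [mN N0 sN]].
have : mu `]0, +oo[%classic = 0%E.
  apply: (subset_measure0 _ _ _ N0) => //.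
  move=> t /= t0; apply: sN => /=; apply/not_implyP; split => //.
  move: t0; rewrite in_itv/= andbT => t0 [] /eqP.
  by rewrite /gamma_integrand mulf_eq0 !gt_eqF ?expR_gt0 ?powR_gt0.
by rewrite lebesgue_measure_itv/= ltry.
Qed.

Lemma lower_upper_gamma (a x : R) : 0 < a -> 0 <= x ->
  lower_gamma a x + upper_gamma a x = Gamma a.
Proof.
move=> a0 x0; rewrite /lower_gamma /upper_gamma /Gamma.
have UE : `]0, +oo[%classic = `]0, x]%classic `|` `]x, +oo[%classic :> set R.
  by apply: itv_bndbnd_setU; rewrite bnd_simp.
rewrite UE Rintegral_setU//.
- by rewrite -UE; exact: integrable_gamma_integrand.
- apply/disj_setPS => t [] /=; rewrite !in_itv/= => /andP[_ tx].
  by rewrite andbT ltNge tx.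
Qed.

End substitution.

(** * Tail moments of an even density *)

Section tail_expectation.
Context (d : measure_display) (T : measurableType d) (R : realType).
Variables (P : probability T R) (Z : {RV P >-> R}) (f : R -> R).
Hypothesis Zf : has_density Z f.
Hypothesis f_even : forall x, f (- x) = f x.
Local Notation mu := (@lebesgue_measure R).

Lemma ge0_expectation_mul_indic (A : set R) : measurable A ->
  A `<=` `[0, +oo[%classic ->
  (\int[P]_w (Z w * \1_A (Z w))%:E = \int[mu]_(x in A) (x * f x)%:E)%E.
Proof.
move=> mA A0.
have mg : measurable_fun [set: R] (fun x : R => (x * \1_A x)%:E).
  apply/measurable_EFinP; apply: measurable_funM => //.
have g0 (x : R) : (0 <= (x * \1_A x)%:E)%E.
  rewrite lee_fin indicE; case: (boolP (x \in A)) => [|_]; last by rewrite mulr0.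
  by rewrite inE => /A0/=; rewrite in_itv/= andbT mulr1.
rewrite (ge0_expectation_density Zf mg g0) [RHS]integral_mkcond.
apply: eq_integral => x _; rewrite patchE indicE.
by case: ifP => _; rewrite ?mulr1// mulr0 mul0e.
Qed.

Hypothesis tail0 : (\int[mu]_(x in `]0%R, +oo[) (x * f x)%:E < +oo)%E.

(** [Z] is the difference of its positive part and of the positive part of
    [- Z], which have the same finite mean. *)
Lemma integrable_even_density : P.-integrable [set: T] (EFin \o Z).
Proof.
pose g (x : R) := x * \1_`]0, +oo[%classic x.
have mg : measurable_fun [set: R] g by apply: measurable_funM.
have gE x : g x = if 0 < x then x else 0.
  rewrite /g indicE; have [x0|x0] := ltP 0 x.
    by rewrite mem_set ?mulr1//= in_itv/= x0.
  by rewrite memNset ?mulr0//= in_itv/= ltNge x0.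
have g0 x : 0 <= g x by rewrite gE; case: ltP => // /ltW.
have gfin : (\int[P]_w (g (Z w))%:E < +oo)%E.
  rewrite ge0_expectation_mul_indic// => x /=; rewrite !in_itv/= !andbT.
  exact: ltW.
have ipos : P.-integrable [set: T] (fun w => (g (Z w))%:E).
  apply/integrableP; split.
    by apply/measurable_EFinP; exact: measurableT_comp.
  by under eq_integral do rewrite /= ger0_norm//.
have ineg : P.-integrable [set: T] (fun w => (g (- Z w))%:E).
  apply/integrableP; split.
    apply/measurable_EFinP; apply: measurableT_comp => //.
    exact: measurableT_comp.
  under eq_integral do rewrite /= ger0_norm//.
  rewrite (ge0_expectation_density_opp Zf f_even (g := EFin \o g))//.
  exact/measurable_EFinP.
have := integrableB measurableT ipos ineg.
apply: eq_integrable => // w _; rewrite /= -EFinB; congr EFin.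
by rewrite !gE oppr_gt0; case: ltgtP => ?; lra.
Qed.

Lemma mean_even_density : \int[P]_w Z w = 0.
Proof.
have mid : measurable_fun [set: R] (@id R) by [].
have oddid (x : R) : id (- x) = - id x by [].
by rewrite /Rintegral (expectation_odd0 Zf f_even mid oddid integrable_even_density).
Qed.

(** For [c > 0] the interval [[- c, c]] contributes nothing, by symmetry; for
    [c <= 0] only the endpoint of the half line differs, and it is a null set. *)
Lemma tail_moment_even_density (c : R) :
  \int[P]_w (Z w * \1_`[- c, +oo[%classic (Z w)) =
  fine (\int[mu]_(x in `]`|c|%R, +oo[) (x * f x)%:E)%E.
Proof.
have iZ := integrable_even_density.
have subpos : `]`|c|, +oo[%classic `<=` (`[0, +oo[%classic : set R).
  move=> x /=; rewrite !in_itv/= !andbT => cx; apply: ltW.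
  by apply: le_lt_trans cx.
have [c0|c0] := leP c 0.
  rewrite /Rintegral ge0_expectation_mul_indic//; last first.
    move=> x /=; rewrite !in_itv/= !andbT; apply: le_trans.
    by rewrite oppr_ge0.
  rewrite ler0_norm// integral_itv_obnd_cbnd//.
  apply/measurable_EFinP/measurable_funTS; apply: measurable_funM => //.
  exact: measurable_density Zf.
have modd : measurable_fun [set: R] (fun x : R => x * \1_`[- c, c]%classic x).
  by apply: measurable_funM.
have iodd := integrable_mul_indic iZ (measurable_itv `[- c, c]).
have itail := integrable_mul_indic iZ (measurable_itv `]c, +oo[).
rewrite -(ge0_expectation_mul_indic _ subpos)// gtr0_norm//.
rewrite -[RHS]add0r -[X in X + _]/(fine 0%E).
rewrite -(expectation_odd0 Zf f_even modd _ iodd); last first.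
  move=> x; rewrite mulNr; congr (- (_ * _)); rewrite !indicE; congr (nat_of_bool _)%:R.
  by rewrite !mem_setE !in_itv/= lerN2 lerNl andbC.
rewrite -[RHS]/(\int[P]_w _ + \int[P]_w _) -RintegralD//.
apply: eq_Rintegral => w _; rewrite -mulrDr; congr (_ * _).
rewrite !indicE.
rewrite !mem_setE !in_itv/= !andbT.
by case: (leP (- c) (Z w)) => ?; case: (leP (Z w) c) => ? //=; lra.
Qed.

End tail_expectation.

(** * The generalized Gaussian density *)

Section generalized_gaussian.
Context (R : realType) (a b : R).
Hypotheses (a_gt0 : 0 < a) (b_gt0 : 0 < b).
Local Notation mu := (@lebesgue_measure R).

Lemma gg_pdf_even z : gg_pdf a b (- z) = gg_pdf a b z.
Proof. by rewrite /gg_pdf mulNr normrN. Qed.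

Lemma gg_pdf_ge0 z : 0 <= gg_pdf a b z.
Proof.
by rewrite mulr_ge0 ?expR_ge0// invr_ge0 !mulr_ge0// ltW// Gamma_gt0.
Qed.

Lemma continuous_gg_pdf (z : R) : 0 < z -> {for z, continuous (gg_pdf a b)}.
Proof.
move=> z0; apply: cvgM; first exact: cvg_cst.
apply: continuous_cvg; first exact: continuous_expR.
apply: cvgN; apply: (@continuous_cvg _ R R _ _ (fun u => `|u / b|) (@powR R ^~ a^-1)).
  by apply: continuous_powR; rewrite normr_gt0 mulf_neq0 ?invr_eq0 ?gt_eqF.
by apply: cvg_norm; apply: cvgM; [exact: cvg_id|exact: cvg_cst].
Qed.

(** Substitute [z = b t^a]: the exponent becomes [- t], and [z dz] becomes
    [a b^2 t^(2a-1) dt]. *)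
Lemma gg_tail_moment (x : R) : 0 <= x ->
  (\int[mu]_(z in `]x, +oo[) (z * gg_pdf a b z)%:E =
   (b / (2 * Gamma a) * upper_gamma (2 * a) ((x / b) `^ a^-1))%:E)%E.
Proof.
move=> x0; set y := (x / b) `^ a^-1.
have xE : b * y `^ a = x.
  rewrite /y -powRrM mulVf ?gt_eqF// powRr1 ?divr_ge0 ?(ltW b_gt0)//.
  by rewrite mulrC divfK// gt_eqF.
have y0 : 0 <= y by exact: powR_ge0.
have Ga0 := Gamma_gt0 a_gt0.
have a20 : 0 < 2 * a by rewrite mulr_gt0.
have yoo_sub : `]y, +oo[%classic `<=` (`]0, +oo[%classic : set R).
  by move=> t /=; rewrite !in_itv/= !andbT; exact: le_lt_trans.
rewrite -{1}xE (ge0_integration_by_substitution_powR a_gt0 b_gt0 y0) ?xE; last 2 first.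
- move=> z; rewrite in_itv/= andbT => xz; apply: cvgM; first exact: cvg_id.
  by apply: continuous_gg_pdf; exact: le_lt_trans xz.
- move=> z; rewrite in_itv/= andbT => xz.
  by rewrite mulr_ge0 ?gg_pdf_ge0// ltW// (le_lt_trans x0).
have iU : mu.-integrable `]y, +oo[ (EFin \o gamma_integrand (2 * a)).
  exact: integrableS (integrable_gamma_integrand a20).
have my : measurable (`]y, +oo[%classic : set (measurableTypeR R)).
  exact: measurable_itv.
rewrite /upper_gamma -(RintegralZl _ my iU) fineK; last first.
  exact: (integrable_fin_num my (integrableZl my (b / (2 * Gamma a)) iU)).
apply: eq_integral => t; rewrite inE => /yoo_sub/=.
rewrite in_itv/= andbT => t0; congr EFin.
have ta0 : 0 < t `^ a by exact: powR_gt0.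
rewrite /gg_pdf /gamma_integrand.
have -> : `|b * t `^ a / b| `^ a^-1 = t.
  rewrite mulrAC divff ?gt_eqF// mul1r gtr0_norm// -powRrM divff ?gt_eqF//.
  by rewrite powRr1// ltW.
have -> : 2 * a - 1 = a + (a - 1) by ring.
rewrite (@powRD _ t a (a - 1)); last by rewrite (gt_eqF t0) implybT.
by field; rewrite !gt_eqF.
Qed.

End generalized_gaussian.

(** * The expected loss *)

Section expected_loss.
Context (d : measure_display) (T : measurableType d) (R : realType).
Variables (P : probability T R) (Z : {RV P >-> R}) (a b k1 k2 : R).
Hypotheses (a_gt0 : 0 < a) (b_gt0 : 0 < b).
Hypothesis Z_density : has_density Z (gg_pdf a b).

Let tail0 : (\int[@lebesgue_measure R]_(z in `]0%R, +oo[)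
  (z * gg_pdf a b z)%:E < +oo)%E.
Proof. by rewrite gg_tail_moment// ltry. Qed.

Lemma integrable_gg : P.-integrable [set: T] (EFin \o Z).
Proof. exact: integrable_even_density Z_density (gg_pdf_even a b) tail0. Qed.

Lemma gg_mean_loss (c : R) :
  \int[P]_w loss k1 k2 (Z w + c) =
  (k1 + k2) * (b / (2 * Gamma a) * upper_gamma (2 * a) (`|c / b| `^ a^-1))
    + mean_slope P Z k1 k2 c * c.
Proof.
rewrite (mean_loss_decomp k1 k2 integrable_gg).
rewrite (mean_even_density Z_density (gg_pdf_even a b) tail0) mulr0 subr0.
rewrite (tail_moment_even_density Z_density (gg_pdf_even a b) tail0).
rewrite (gg_tail_moment a_gt0 b_gt0 (normr_ge0 c)) /=.
by have -> : `|c / b| = `|c| / b by rewrite normrM normfV (gtr0_norm b_gt0).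
Qed.

Lemma expectation_loss_EFin (c : R) :
  ('E_P[fun w => loss k1 k2 (Z w + c)] =
   (\int[P]_w loss k1 k2 (Z w + c))%:E)%E.
Proof.
rewrite unlock fineK//; apply: integrable_fin_num => //.
exact: (integrable_loss k1 k2 integrable_gg).
Qed.

End expected_loss.

Unset Implicit Arguments.

Theorem corollary2 (d : measure_display) (T : measurableType d)
    (R : realType) (P : probability T R) (Z : {RV P >-> R})
    (a b k1 k2 C : R)
    (a_gt0 : 0 < a) (b_gt0 : 0 < b) (k1_gt0 : 0 < k1) (k2_gt0 : 0 < k2)
    (Z_density : has_density Z (gg_pdf a b))
    (C_critical :
       is_derive C 1
         (fun c : R => fine ('E_P[fun w => loss k1 k2 (Z w + c)])%E) (0 : R)) :
  ('E_P[fun w => loss k1 k2 (Z w)] - 'E_P[fun w => loss k1 k2 (Z w + C)] =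
     ((k1 + k2) * b / (2 * Gamma a)
        * lower_gamma (2 * a) (`|C / b| `^ a^-1))%:E)%E /\
  ('E_P[fun w => loss k1 k2 (Z w + C)] / 'E_P[fun w => loss k1 k2 (Z w)] =
     ((Gamma (2 * a))^-1
        * upper_gamma (2 * a) (`|C / b| `^ a^-1))%:E)%E.
Proof.
have k_gt0 : 0 < k1 + k2 by exact: addr_gt0.
have sC : mean_slope P Z k1 k2 C = 0.
  apply: (mean_slope_critical (integrable_gg a_gt0 b_gt0 Z_density)); first exact: ltW.
  by move: C_critical; rewrite unlock.
have EC := expectation_loss_EFin k1 k2 a_gt0 b_gt0 Z_density C.
rewrite (gg_mean_loss k1 k2 a_gt0 b_gt0 Z_density) sC mul0r addr0 in EC.
have E0 := expectation_loss_EFin k1 k2 a_gt0 b_gt0 Z_density 0.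
rewrite (gg_mean_loss k1 k2 a_gt0 b_gt0 Z_density) mulr0 addr0 in E0.
rewrite mul0r normr0 powR0 ?invr_eq0 ?gt_eqF// in E0.
have {}E0 : ('E_P[fun w => loss k1 k2 (Z w)] =
    ((k1 + k2) * (b / (2 * Gamma a) * Gamma (2 * a)))%:E)%E.
  rewrite -[RHS]E0; congr expectation; apply/funext => w.
  by rewrite addr0.
have Ga_gt0 := Gamma_gt0 a_gt0.
have a2_gt0 : 0 < 2 * a by rewrite mulr_gt0.
have G2a_gt0 := Gamma_gt0 a2_gt0.
rewrite EC {}E0; split.
  rewrite -EFinB -(lower_upper_gamma a2_gt0 (powR_ge0 `|C / b| a^-1)).
  by congr EFin; field; rewrite gt_eqF.
rewrite inver ifF; last first.
  by apply: gt_eqF; rewrite !mulr_gt0// invr_gt0 mulr_gt0.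
by rewrite -EFinM; congr EFin; field; rewrite !gt_eqF.
Qed.
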